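(* Let $n \geq 3$ be an integer. Then no right-angled Artin group is abstractly commensurable with $\mathrm{Out}(\mathbb{Z}^n) \cong \mathrm{GL}_n(\mathbb{Z})$.
   Context: Two groups are abstractly commensurable if they have isomorphic finite-index subgroups. To a finite (simplicial) graph $\Gamma$ one associates a right-angled Artin group: the group with one generator for each vertex of $\Gamma$ and one defining relator for each edge, namely the commutator of the two generators corresponding to the endpoints of the edge. $\mathrm{Out}$ denotes the outer automorphism group. *)

(* Defs.v *)
From HB Require Import structures.
From mathcomp Require Import all_boot all_order all_algebra.
From mathcomp Require Import all_classical.

Set Implicit Arguments.
Unset Strict Implicit.
Unset Printing Implicit Defensive.

Import GRing.Theory.

Local Open Scope quotient_scope.
Local Open Scope group_scope.

Definition isomorphic (G H : groupType) : Prop :=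
  exists f : {multiplicative G -> H}, bijective f.

Section Subgroup.
Variables (G : groupType) (S : groupClosed G).

Definition subgroup : Type := {x : G | x \in S}.

HB.instance Definition _ := SubChoice.on subgroup.

Lemma subgroup_closed : group_closed (fun x : G => x \in S).
Proof. by split=> [|x y xS yS]; [exact: gpred1 | exact: gpredF]. Qed.

HB.instance Definition _ :=
  SubChoice_isSubGroup.Build G (fun x => x \in S) subgroup subgroup_closed.

Definition left_coset (x : G) : set G := [set x * s | s in [set` S]].

Definition finite_index : Prop := finite_set (range left_coset).

End Subgroup.

Definition commensurable (G H : groupType) : Prop :=
  exists (U : groupClosed G) (V : groupClosed H),
    [/\ finite_index U, finite_index V &
        isomorphic (subgroup U) (subgroup V)].

Section Quotient.
Variables (G : groupType) (N : groupClosed G).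
Hypothesis N_normal : forall x y : G, x \in N -> x ^ y \in N.

Definition same_coset (x y : G) : bool := x^-1 * y \in N.

Lemma same_coset_equiv : equiv_class_of same_coset.
Proof.
split=> [x|x y|y x z]; rewrite /same_coset.
- by rewrite mulVg gpred1.
- by rewrite -gpredV invgM invgK.
- move=> xy yz; have -> : x^-1 * z = (x^-1 * y) * (y^-1 * z).
    by rewrite mulgA mulgK.
  exact: gpredM.
Qed.

Canonical same_coset_rel := EquivRelPack same_coset_equiv.

(* The argument [N_normal] is kept so that the group structure below can be
   found from the type alone. *)
Definition quotient_group of (forall x y : G, x \in N -> x ^ y \in N) : Type :=
  {eq_quot same_coset_rel}.

Local Notation Q := (quotient_group N_normal).

HB.instance Definition _ := Choice.on Q.
HB.instance Definition _ := EqQuotient.on Q.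

Definition quotient_mul (a b : Q) : Q := \pi_Q (repr a * repr b).
Definition quotient_inv (a : Q) : Q := \pi_Q ((repr a)^-1).

Lemma quotient_piM x y : quotient_mul (\pi_Q x) (\pi_Q y) = \pi_Q (x * y).
Proof.
apply/eqmodP; rewrite /= /same_coset.
case: piP => x' /eqmodP; case: piP => y' /eqmodP; rewrite /= /same_coset.
move=> yy' xx'.
have -> : (x' * y')^-1 * (x * y) = ((x^-1 * x')^-1) ^ y' * (y^-1 * y')^-1.
  by rewrite conjgE !gnorm.
by rewrite gpredM ?gpredV ?N_normal ?gpredV.
Qed.

Lemma quotient_piV x : quotient_inv (\pi_Q x) = \pi_Q (x^-1).
Proof.
apply/eqmodP; rewrite /= /same_coset invgK.
case: piP => x' /eqmodP; rewrite /= /same_coset => xx'.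
have -> : x' * x^-1 = (x^-1 * x') ^ x^-1 by rewrite conjgE !gnorm.
exact: N_normal.
Qed.

Lemma quotient_mulA : associative quotient_mul.
Proof.
move=> a b c; elim/(@quotW _ Q): a => x; elim/(@quotW _ Q): b => y.
elim/(@quotW _ Q): c => z.
by rewrite !quotient_piM mulgA.
Qed.

Lemma quotient_1mul : left_id (\pi_Q 1) quotient_mul.
Proof. by move=> a; elim/(@quotW _ Q): a => x; rewrite quotient_piM mul1g. Qed.

Lemma quotient_mul1 : right_id (\pi_Q 1) quotient_mul.
Proof. by move=> a; elim/(@quotW _ Q): a => x; rewrite quotient_piM mulg1. Qed.

Lemma quotient_mulV : left_inverse (\pi_Q 1) quotient_inv quotient_mul.
Proof.
by move=> a; elim/(@quotW _ Q): a => x; rewrite quotient_piV quotient_piM mulVg.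
Qed.

Lemma quotient_Vmul : right_inverse (\pi_Q 1) quotient_inv quotient_mul.
Proof.
by move=> a; elim/(@quotW _ Q): a => x; rewrite quotient_piV quotient_piM mulgV.
Qed.

HB.instance Definition _ := isGroup.Build Q
  quotient_mulA quotient_1mul quotient_mul1 quotient_mulV quotient_Vmul.

End Quotient.


Section Outer.
Variable G : groupType.

Definition automorphic (f : G -> G) : Prop :=
  bijective f /\ {morph f : x y / x * y}.

Definition aut : Type := {f : G -> G | `[< automorphic f >]}.

HB.instance Definition _ := SubChoice.on aut.

Definition aut_fun (f : aut) : G -> G := val f.
Coercion aut_fun : aut >-> Funclass.

Lemma autP (f : aut) : automorphic f.
Proof. exact/asboolP/(valP f). Qed.

Lemma autM (f : aut) : {morph f : x y / x * y}.
Proof. by case: (autP f). Qed.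

Lemma aut_eqP (f g : aut) : f =1 g -> f = g.
Proof. by move=> fg; apply/val_inj/funext. Qed.

Definition mk_aut (f : G -> G) (fP : automorphic f) : aut :=
  exist _ f (asboolT fP).

Lemma aut_one_subproof : automorphic id.
Proof. by split=> //; exists id. Qed.

Lemma aut_mul_subproof (f g : aut) : automorphic (f \o g).
Proof.
case: (autP f) (autP g) => [fb fM] [gb gM]; split; first exact: bij_comp.
by move=> x y /=; rewrite gM fM.
Qed.

Lemma aut_inv_exists (f : aut) : exists g : G -> G, cancel f g /\ cancel g f.
Proof. by case: (autP f) => -[g fg gf] _; exists g. Qed.

Definition aut_inv_fun (f : aut) : G -> G := sval (cid (aut_inv_exists f)).

Lemma aut_funK (f : aut) : cancel f (aut_inv_fun f).
Proof. by case: (svalP (cid (aut_inv_exists f))). Qed.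

Lemma aut_invK (f : aut) : cancel (aut_inv_fun f) f.
Proof. by case: (svalP (cid (aut_inv_exists f))). Qed.

Lemma aut_inv_subproof (f : aut) : automorphic (aut_inv_fun f).
Proof.
split; first by exists f; [exact: aut_invK | exact: aut_funK].
by move=> x y; apply: (can_inj (aut_funK f)); rewrite autM !aut_invK.
Qed.

Definition aut_one := mk_aut aut_one_subproof.
Definition aut_mul f g := mk_aut (aut_mul_subproof f g).
Definition aut_inv f := mk_aut (aut_inv_subproof f).

Lemma aut_mulA : associative aut_mul.
Proof. by move=> f g h; exact: aut_eqP. Qed.
Lemma aut_1mul : left_id aut_one aut_mul.
Proof. by move=> f; exact: aut_eqP. Qed.
Lemma aut_mul1 : right_id aut_one aut_mul.
Proof. by move=> f; exact: aut_eqP. Qed.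
Lemma aut_mulV : left_inverse aut_one aut_inv aut_mul.
Proof. by move=> f; apply: aut_eqP => x; exact: aut_funK. Qed.
Lemma aut_Vmul : right_inverse aut_one aut_inv aut_mul.
Proof. by move=> f; apply: aut_eqP => x; exact: aut_invK. Qed.

HB.instance Definition _ :=
  isGroup.Build aut aut_mulA aut_1mul aut_mul1 aut_mulV aut_Vmul.

Definition inn : {pred aut} :=
  fun f => `[< exists g : G, forall x, f x = g * x * g^-1 >].

Lemma inn_one : 1 \in inn.
Proof. by apply/asboolP; exists 1 => x; rewrite invg1 mulg1 mul1g. Qed.

Lemma inn_mul : mulg_closed inn.
Proof.
move=> f1 f2 /asboolP[g1 Eg1] /asboolP[g2 Eg2]; apply/asboolP.
by exists (g1 * g2) => x; rewrite [LHS]Eg1 Eg2 invgM !mulgA.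
Qed.

Lemma inn_inv : invg_closed inn.
Proof.
move=> f /asboolP[g Eg]; apply/asboolP; exists g^-1 => x.
apply: (can_inj (aut_funK f)); rewrite [LHS]aut_invK Eg invgK !mulgA.
by rewrite mulgV mul1g mulgK.
Qed.

HB.instance Definition _ := isMulClosed.Build aut inn inn_mul.
HB.instance Definition _ := isMul1Closed.Build aut inn inn_one.
HB.instance Definition _ := isInvClosed.Build aut inn inn_inv.

Lemma inn_normal (f h : aut) : f \in inn -> f ^ h \in inn.
Proof.
move=> /asboolP[g Eg]; apply/asboolP; exists (aut_inv_fun h g) => x.
apply: (can_inj (aut_funK h)); rewrite [LHS]aut_invK [LHS]Eg !autM.
have hV : h ((aut_inv_fun h g)^-1) = g^-1.
  apply: (mulgI g); rewrite mulgV -{1}[g](aut_invK h g) -autM mulgV.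
  by apply: (mulgI (h 1)); rewrite -autM !mulg1.
by rewrite hV aut_invK.
Qed.

Definition out : groupType := quotient_group inn_normal.

End Outer.

Section GeneralLinear.
Variables (R : comUnitRingType) (n : nat).

(* ['M_n] has a [unitRingType] structure only when [n] is a successor, hence
   [unitmx] rather than [GRing.unit]. *)
Definition GL : Type := {A : 'M[R]_n | A \in unitmx}.

HB.instance Definition _ := SubChoice.on GL.

Definition GL_one : GL := exist _ (1%:M)%R (unitmx1 R n).

Lemma GL_mul_subproof (A B : GL) : (val A *m val B)%R \in unitmx.
Proof. by rewrite unitmx_mul (valP A) (valP B). Qed.

Lemma GL_inv_subproof (A : GL) : invmx (val A) \in unitmx.
Proof. by rewrite unitmx_inv (valP A). Qed.

Definition GL_mul (A B : GL) : GL :=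
  exist _ (val A *m val B)%R (GL_mul_subproof A B).
Definition GL_inv (A : GL) : GL := exist _ (invmx (val A)) (GL_inv_subproof A).

Lemma GL_mulA : associative GL_mul.
Proof. by move=> A B C; apply/val_inj/mulmxA. Qed.
Lemma GL_1mul : left_id GL_one GL_mul.
Proof. by move=> A; apply/val_inj/mul1mx. Qed.
Lemma GL_mul1 : right_id GL_one GL_mul.
Proof. by move=> A; apply/val_inj/mulmx1. Qed.
Lemma GL_mulV : left_inverse GL_one GL_inv GL_mul.
Proof. by move=> A; apply/val_inj/mulVmx/valP. Qed.
Lemma GL_Vmul : right_inverse GL_one GL_inv GL_mul.
Proof. by move=> A; apply/val_inj/mulmxV/valP. Qed.

HB.instance Definition _ :=
  isGroup.Build GL GL_mulA GL_1mul GL_mul1 GL_mulV GL_Vmul.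

End GeneralLinear.

Section Presentation.
Variable T : choiceType.

(* [(x, false)] stands for the generator [x] and [(x, true)] for [x^-1]. *)
Definition word : Type := seq (T * bool).

HB.instance Definition _ := Choice.on word.

Definition letter_inv (a : T * bool) : T * bool := (a.1, ~~ a.2).
Definition word_inv (w : word) : word := rev (map letter_inv w).

Variable R : set word.

(* The congruence on words generated by [a a^-1 = 1] for every letter [a] and
   by [r = 1] for every relator [r]. *)
Inductive word_eq : word -> word -> Prop :=
| word_eq_refl w : word_eq w w
| word_eq_sym w1 w2 : word_eq w1 w2 -> word_eq w2 w1
| word_eq_trans w1 w2 w3 : word_eq w1 w2 -> word_eq w2 w3 -> word_eq w1 w3
| word_eq_cancel u v a : word_eq (u ++ [:: a; letter_inv a] ++ v) (u ++ v)
| word_eq_relator u v r : R r -> word_eq (u ++ r ++ v) (u ++ v).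

Definition word_eqb (w1 w2 : word) : bool := `[< word_eq w1 w2 >].

Lemma word_eqb_equiv : equiv_class_of word_eqb.
Proof.
split=> [w|w1 w2|w2 w1 w3].
- exact/asboolP/word_eq_refl.
- by apply/asboolP/asboolP; exact: word_eq_sym.
- by move=> /asboolP w12 /asboolP w23; apply/asboolP/(word_eq_trans w12).
Qed.

Canonical word_eqb_rel := EquivRelPack word_eqb_equiv.

Definition presented : Type := {eq_quot word_eqb_rel}.

HB.instance Definition _ := Choice.on presented.
HB.instance Definition _ := EqQuotient.on presented.

Lemma word_eq_catl w u v : word_eq u v -> word_eq (w ++ u) (w ++ v).
Proof.
elim=> {u v} [u|u v _ IH|u v x _ IHu _ IHx|u v a|u v r Rr].
- exact: word_eq_refl.
- exact: word_eq_sym.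
- exact: word_eq_trans IHu IHx.
- by rewrite !(catA w); exact: word_eq_cancel.
- by rewrite !(catA w); exact: word_eq_relator.
Qed.

Lemma word_eq_catr w u v : word_eq u v -> word_eq (u ++ w) (v ++ w).
Proof.
elim=> {u v} [u|u v _ IH|u v x _ IHu _ IHx|u v a|u v r Rr].
- exact: word_eq_refl.
- exact: word_eq_sym.
- exact: word_eq_trans IHu IHx.
- by rewrite -!catA; exact: word_eq_cancel.
- by rewrite -!catA; exact: word_eq_relator.
Qed.

Lemma letter_invK : involutive letter_inv.
Proof. by case=> x b; rewrite /letter_inv /= negbK. Qed.

Lemma word_invK : involutive word_inv.
Proof. by move=> w; rewrite /word_inv map_rev revK (mapK letter_invK). Qed.

Lemma word_eq_mulV w : word_eq (w ++ word_inv w) [::].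
Proof.
elim: w => [|a w IH]; first exact: word_eq_refl.
rewrite /word_inv /= rev_cons -cats1 catA.
apply: word_eq_trans (word_eq_cancel [::] [::] a).
exact: (word_eq_catl [:: a] (word_eq_catr [:: letter_inv a] IH)).
Qed.

Lemma word_eq_Vmul w : word_eq (word_inv w ++ w) [::].
Proof. by rewrite -{2}[w]word_invK; exact: word_eq_mulV. Qed.

Lemma word_eq_inv u v : word_eq u v -> word_eq (word_inv u) (word_inv v).
Proof.
move=> uv; apply: word_eq_trans (word_eq_catr (word_inv v) (word_eq_Vmul u)).
rewrite -catA -[X in word_eq X _]cats0; apply: word_eq_catl; apply: word_eq_sym.
exact: word_eq_trans (word_eq_catr _ uv) (word_eq_mulV v).
Qed.

Definition presented_mul (a b : presented) : presented :=
  \pi_presented (repr a ++ repr b).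
Definition presented_inv (a : presented) : presented :=
  \pi_presented (word_inv (repr a)).

Lemma presented_piP (u v : word) :
  word_eq u v <-> \pi_presented u = \pi_presented v.
Proof. by split=> [uv|/eqmodP/asboolP//]; apply/eqmodP/asboolP. Qed.

Lemma presented_piM (u v : word) :
  presented_mul (\pi_presented u) (\pi_presented v) = \pi_presented (u ++ v).
Proof.
apply/presented_piP; case: piP => u' /presented_piP uu'.
case: piP => v' /presented_piP vv'; apply: word_eq_sym.
exact: word_eq_trans (word_eq_catr _ uu') (word_eq_catl _ vv').
Qed.

Lemma presented_piV (u : word) :
  presented_inv (\pi_presented u) = \pi_presented (word_inv u).
Proof.
apply/presented_piP; case: piP => u' /presented_piP uu'.
exact/word_eq_sym/word_eq_inv.
Qed.

Lemma presented_mulA : associative presented_mul.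
Proof.
move=> a b c; elim/(@quotW _ presented): a => x.
elim/(@quotW _ presented): b => y; elim/(@quotW _ presented): c => z.
by rewrite !presented_piM catA.
Qed.

Lemma presented_1mul : left_id (\pi_presented [::]) presented_mul.
Proof.
by move=> a; elim/(@quotW _ presented): a => x; rewrite presented_piM.
Qed.

Lemma presented_mul1 : right_id (\pi_presented [::]) presented_mul.
Proof.
by move=> a; elim/(@quotW _ presented): a => x; rewrite presented_piM cats0.
Qed.

Lemma presented_mulV : left_inverse
    (\pi_presented [::]) presented_inv presented_mul.
Proof.
move=> a; elim/(@quotW _ presented): a => x.
rewrite presented_piV presented_piM.
exact/presented_piP/word_eq_Vmul.
Qed.

Lemma presented_Vmul : right_inverse
    (\pi_presented [::]) presented_inv presented_mul.
Proof.
move=> a; elim/(@quotW _ presented): a => x.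
rewrite presented_piV presented_piM.
exact/presented_piP/word_eq_mulV.
Qed.

HB.instance Definition _ := isGroup.Build presented
  presented_mulA presented_1mul presented_mul1 presented_mulV presented_Vmul.

End Presentation.

Definition commutator_word (T : choiceType) (x y : T) : word T :=
  [:: (x, true); (y, true); (x, false); (y, false)].

(* When [e] is the adjacency relation of a graph, an edge [{x, y}] gives both
   [[x, y]] and its inverse [[y, x]], which impose the same relation. *)
Definition RAAG (T : finType) (e : rel T) : groupType :=
  presented [set commutator_word p.1 p.2 | p in [set p : T * T | e p.1 p.2]].

(* Main.v *)
From HB Require Import structures.
Require Import Defs.
From mathcomp Require Import all_boot all_order all_algebra.
From mathcomp Require Import boolp classical_sets cardinality.
From mathcomp Require Import zify.

(** The obstruction is the integral Heisenberg relation: elements x, y, z with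
    [x y = y x z] and z commuting with x and y.

    A right-angled Artin group contains no such triple with [z <> 1]
    ([no_heisenberg]).  The relation gives [x^n y^n = y^n x^n z^(n^2)], so
    [z^(n^2)] is spelled by a word of length linear in n
    ([heisenberg_powers]).  On the other hand cyclic subgroups of a
    right-angled Artin group are undistorted ([undistorted]): every element is
    conjugate to one spelled by a word all of whose powers are reduced
    ([cyclically_reduced]), and reduced words have minimal length.  Quadratic
    growth inside a linear bound is impossible.

    That reduced words have minimal length is proved with the piles of Crisp,
    Godelle and Wiest: the group acts on families of stacks, one for each
    generator, and the number of signs in the pile of a word is an invariant
    of the element, bounded by the length of any word spelling it, and equal
    to that length when no letter cancels ([run_word_eq], [weight_run],
    [weight_stack], [run_stackVcancel]).

    In [GL_n(Z)] with [n >= 3], the elementary matrices E_12, E_23 and E_13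
    form a Heisenberg triple, and E_13 has infinite order.  Suitable powers of
    them lie in any given finite-index subgroup, so the absence of Heisenberg
    triples on one side of a commensuration would force E_13 to have finite
    order ([commensurable_heisenberg]).

    Finally [Z^n] is abelian, so it has no nontrivial inner automorphism, and
    an additive self-map of [Z^n] is the product with a matrix; this identifies
    [Out(Z^n)] with [GL_n(Z)] ([isomorphic_out_GL]). *)

Set Implicit Arguments.
Unset Strict Implicit.
Unset Printing Implicit Defensive.

(** * Piles: a length function on right-angled Artin groups *)

Section Piles.
Variables (T : finType) (e : rel T).
Hypotheses (e_sym : symmetric e) (e_irr : irreflexive e).
Implicit Types (a b : T * bool) (v : T) (w : word T).

(** A pile is a family of stacks.  [Some s] on the stack of [v] records a letter
    [v] with sign [s]; [None] is a marker left there by a letter that does not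
    commute with [v], and it blocks the letters below it. *)
Definition pile := T -> seq (option bool).

Implicit Types P Q : pile.

Definition push a P : pile := fun x =>
  if x == a.1 then Some a.2 :: P x else if e a.1 x then P x else None :: P x.

Definition pop v P : pile := fun x => if e v x then P x else behead (P x).

Definition top P v : option bool := head None (P v).

(** The action of a letter on reduced words by right multiplication, read on
    piles: the letter cancels exactly when its inverse is exposed. *)
Definition step P a : pile :=
  if top P a.1 == Some (~~ a.2) then pop a.1 P else push a P.

Definition empty_pile : pile := fun=> [::].

(** [pop] undoes [push] only when the markers that it removes are the ones that
    the popped letter left, so the action is only considered on the piles built
    from cancellation-free additions. *)
Inductive legal : pile -> Prop :=
| legal_empty : legal empty_pile
| legal_push P a : legal P -> top P a.1 != Some (~~ a.2) -> legal (push a P).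

Lemma push_pop a P : pop a.1 (push a P) = P.
Proof.
apply/funext => w; rewrite /pop /push; case: (eqVneq w a.1) => [->|_].
  by rewrite e_irr.
by case: (e a.1 w).
Qed.

Lemma top_push a P : top (push a P) a.1 = Some a.2.
Proof. by rewrite /top /push eqxx. Qed.

Lemma top_push_adj a P v : e a.1 v -> top (push a P) v = top P v.
Proof.
by move=> av; rewrite /top /push av; case: eqVneq av => // ->; rewrite e_irr.
Qed.

Lemma top_push_nadj a P v : v != a.1 -> ~~ e a.1 v -> top (push a P) v = None.
Proof. by rewrite /top /push => /negPf-> /negPf->. Qed.

Lemma top_pop_adj v (w : T) P : e v w -> top (pop v P) w = top P w.
Proof. by rewrite /top /pop => ->. Qed.

Lemma pushC a b P : e a.1 b.1 -> push a (push b P) = push b (push a P).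
Proof.
move=> ab; apply/funext => w; rewrite /push.
case: (eqVneq w a.1) => [->|wa].
  case: (eqVneq a.1 b.1) ab => [->|_ ab]; first by rewrite e_irr.
  by rewrite e_sym ab.
case: (eqVneq w b.1) => [->|wb]; first by rewrite ab.
by case: (e a.1 w); case: (e b.1 w).
Qed.

(** An exposed letter could have been added last: every later letter commutes
    with it, for otherwise it would be covered by a marker. *)
Lemma legal_top P v s : legal P -> top P v = Some s ->
  exists Q, [/\ legal Q, top Q v != Some (~~ s) & P = push (v, s) Q].
Proof.
elim=> {P} [//|P [w t] lP IH wP].
case: (eqVneq v w) wP => [->|vw] wP.
  by rewrite top_push => -[<-]; exists P.
case: (boolP (e w v)) => [wv|nwv]; last by rewrite top_push_nadj.
rewrite top_push_adj // => /IH[Q [lQ vQ PQ]].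
exists (push (w, t) Q); split; last by rewrite PQ pushC.
- by apply: legal_push => //; move: wP; rewrite PQ top_push_adj //= e_sym.
- by rewrite top_push_adj.
Qed.

Variant step_spec P a : pile -> Prop :=
| StepPush of top P a.1 != Some (~~ a.2) : step_spec P a (push a P)
| StepPop Q of legal Q & top Q a.1 != Some a.2 & P = push (letter_inv a) Q :
    step_spec P a Q.

Lemma stepP P a : legal P -> step_spec P a (step P a).
Proof.
move=> lP; rewrite /step; case: eqVneq => [aP|]; last exact: StepPush.
have [Q [lQ aQ PQ]] := legal_top lP aP.
rewrite negbK in aQ; rewrite {2}PQ (push_pop (a.1, _)); exact: StepPop.
Qed.

Lemma step_legal P a : legal P -> legal (step P a).
Proof.
by move=> lP; case: (stepP a lP) => // aP; apply: legal_push.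
Qed.

Lemma step_inv P a : legal P -> step (step P a) (letter_inv a) = P.
Proof.
move=> lP; case: (stepP a lP) => [_|Q _ aQ ->].
  by rewrite /step top_push negbK eqxx (push_pop a).
by rewrite /step negbK (negPf aQ).
Qed.

(** Commuting letters act on disjoint sets of signs, and where they leave
    markers on a common stack the markers are indistinguishable. *)
Lemma step_push P a b : legal P -> e a.1 b.1 ->
  step (push b P) a = push b (step P a).
Proof.
move=> lP ab; rewrite {1}/step top_push_adj 1?e_sym //.
rewrite /step; case: eqVneq => [aP|_]; last by rewrite pushC.
have [Q [_ _ ->]] := legal_top lP aP.
by rewrite (push_pop (a.1, _)) pushC 1?e_sym // (push_pop (a.1, _)).
Qed.

Lemma top_step_adj P a v : e a.1 v -> top (step P a) v = top P v.
Proof.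
by move=> av; rewrite /step; case: ifP; rewrite ?top_push_adj ?top_pop_adj.
Qed.

Lemma stepC P a b : legal P -> e a.1 b.1 ->
  step (step P a) b = step (step P b) a.
Proof.
move=> lP ab; case: (stepP b lP) => [bP|Q lQ bQ PQ].
  by rewrite step_push // {1}/step top_step_adj // (negPf bP).
rewrite PQ step_push // {1}/step (top_push (letter_inv b)) eqxx.
exact: (push_pop (letter_inv b)).
Qed.

Definition run P (w : word T) : pile := foldl step P w.

Lemma run_legal w P : legal P -> legal (run P w).
Proof. by elim: w P => //= a w IH P lP; apply/IH/step_legal. Qed.

Definition raag_relators : set (word T) :=
  [set commutator_word p.1 p.2 | p in [set p : T * T | e p.1 p.2]].

(** The group acts on legal piles: a letter and its inverse undo each other, and
    adjacent generators act in either order. *)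
Lemma run_word_eq (w1 w2 : word T) P :
  word_eq raag_relators w1 w2 -> legal P -> run P w1 = run P w2.
Proof.
move=> w12; elim: w12 P => {w1 w2} //.
- by move=> w1 w2 _ IH P lP; rewrite IH.
- by move=> w1 w2 w3 _ IH1 _ IH2 P lP; rewrite IH1 // IH2.
- by move=> u v a P lP; rewrite /run !foldl_cat /= step_inv //;
  apply: run_legal.
- move=> u v _ [[x y] /= xy <-] P lP; rewrite /run !foldl_cat -/(run P u) /=.
  have lQ := run_legal u lP.
  (* swapping the two middle letters turns the commutator into two cancelling
     pairs *)
  rewrite [step (step _ _) (x, false)]stepC //=; last by rewrite e_sym.
    by rewrite (step_inv (x, true)) // (step_inv (y, true)).
  exact: step_legal.
Qed.

Definition weight P := \sum_v count isSome (P v).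

Lemma weight_push a P : weight (push a P) = (weight P).+1.
Proof.
rewrite /weight (bigD1 a.1) //= [in RHS](bigD1 a.1) //= -addSn /push eqxx.
by congr addn; apply: eq_bigr => w /negPf->; case: (e a.1 w).
Qed.

(** An upper bound suffices, and it needs no legality: on an arbitrary pile,
    popping may delete signs from other stacks besides the one it cancels. *)
Lemma weight_step a P : weight (step P a) <= (weight P).+1.
Proof.
rewrite /step; case: ifP => _; last by rewrite weight_push.
apply/leqW/leq_sum => w _; rewrite /pop; case: (e a.1 w) => //.
by case: (P w) => //= s t; apply: leq_addl.
Qed.

Lemma weight_run w : weight (run empty_pile w) <= size w.
Proof.
elim/last_ind: w => [|w a IH].
  by rewrite /weight big1.
by rewrite /run foldl_rcons size_rcons (leq_trans (weight_step _ _)).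
Qed.

Definition stack (w : word T) : pile :=
  foldl (fun P a => push a P) empty_pile w.

Lemma weight_stack w : weight (stack w) = size w.
Proof.
elim/last_ind: w => [|w a IH]; first by rewrite /weight big1.
by rewrite /stack foldl_rcons size_rcons weight_push -/(stack w) IH.
Qed.

Lemma top_stack w v s : top (stack w) v = Some s ->
  exists p q, w = p ++ (v, s) :: q /\ all (fun b => e v b.1) q.
Proof.
elim/last_ind: w => [//|w b IH]; rewrite /stack foldl_rcons -/(stack w).
case: (eqVneq v b.1) => [->|vb].
  rewrite top_push => -[<-]; exists w, [::].
  by rewrite cats1 -surjective_pairing.
case: (boolP (e b.1 v)) => [bv|nbv]; last by rewrite top_push_nadj.
rewrite top_push_adj // => /IH[p [q [-> qP]]].
exists p, (rcons q b); rewrite rcons_cat rcons_cons all_rcons qP andbT.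
by rewrite e_sym.
Qed.

(** The first letter that cancels does so against an exposed inverse, and an
    exposed letter is followed only by letters commuting with it. *)
Lemma run_stackVcancel w :
  run empty_pile w = stack w \/
  exists p a q r, w = p ++ a :: q ++ letter_inv a :: r /\
                  all (fun b => e a.1 b.1) q.
Proof.
elim/last_ind: w => [|w b IH]; first by left.
case: IH => [IH|[p [a [q [r [-> aq]]]]]]; last first.
  right; exists p, a, q, (rcons r b).
  by rewrite rcons_cat rcons_cons rcons_cat rcons_cons.
rewrite /run /stack !foldl_rcons -/(run _ _) -/(stack w) IH /step.
case: eqVneq => [/top_stack[p [q [-> bq]]]|_]; last by left.
right; exists p, (letter_inv b), q, [::].
by rewrite letter_invK /= cats1 rcons_cat rcons_cons.
Qed.

End Piles.

(** * Cyclic subgroups of right-angled Artin groups are undistorted *)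

Section WordLength.
Variables (T : finType) (e : rel T).
Hypotheses (e_sym : symmetric e) (e_irr : irreflexive e).
Local Open Scope group_scope.
Local Open Scope quotient_scope.
Implicit Types (a b : T * bool) (u w : word T).

Definition eval w : RAAG e := \pi_(presented (raag_relators e)) w.

Lemma eval_cat u w : eval (u ++ w) = eval u * eval w.
Proof. exact/esym/presented_piM. Qed.

Lemma eval_inv w : eval (word_inv w) = (eval w)^-1.
Proof. exact/esym/presented_piV. Qed.

Lemma eval_nil : eval [::] = 1.
Proof. by []. Qed.

Lemma eval_cons a w : eval (a :: w) = eval [:: a] * eval w.
Proof. exact: (eval_cat [:: a]). Qed.

Lemma eval_surj (g : RAAG e) : exists w, eval w = g.
Proof. by exists (repr g); apply: reprK. Qed.

Lemma eval_letter_inv a : eval [:: letter_inv a] = (eval [:: a])^-1.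
Proof. by rewrite -eval_inv. Qed.

Lemma eval_adj a b : e a.1 b.1 -> commute (eval [:: a]) (eval [:: b]).
Proof.
move=> ab.
have xy : commute (eval [:: (a.1, false)]) (eval [:: (b.1, false)]).
  apply/commgP/eqP; rewrite commgEl conjgE mulgA.
  have: eval [:: (a.1, true); (b.1, true); (a.1, false); (b.1, false)] = 1.
    have := word_eq_relator (R := raag_relators e) [::] [::].
    by move=> /(_ _ (ex_intro2 _ _ (a.1, b.1) ab erefl))/presented_piP.
  rewrite eval_cons (eval_cons (b.1, true)) (eval_cons (a.1, false)).
  rewrite (eval_letter_inv (a.1, false)) (eval_letter_inv (b.1, false)).
  by rewrite mulgA.
have E c : eval [:: c] = eval [:: (c.1, false)] \/
    eval [:: c] = (eval [:: (c.1, false)])^-1.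
  by case: c => x []; [right; rewrite -eval_letter_inv | left].
case: (E a) => ->; case: (E b) => -> //.
- exact: commuteV.
- exact/commute_sym/commuteV/commute_sym.
- exact/commuteV/commute_sym/commuteV/commute_sym.
Qed.

Lemma eval_cancel a q : all (fun b => e a.1 b.1) q ->
  eval (a :: q ++ [:: letter_inv a]) = eval q.
Proof.
move=> aq; rewrite eval_cons eval_cat eval_letter_inv.
suff aC : commute (eval [:: a]) (eval q) by rewrite mulgA aC mulgK.
elim: q aq => [_|b q IH /= /andP[ab /IH aq]]; first exact: commute1.
by rewrite (eval_cons b); apply: commuteM => //; apply: eval_adj.
Qed.

Definition wpow k w : word T := flatten (nseq k w).

Lemma size_wpow k w : size (wpow k w) = (k * size w)%N.
Proof. by rewrite size_flatten /shape map_nseq sumn_nseq mulnC. Qed.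

Lemma eval_wpow k w : eval (wpow k w) = eval w ^+ k.
Proof. by elim: k => [|k IH] //; rewrite eval_cat IH expgS. Qed.

Lemma wpow_nil k : wpow k [::] = [::].
Proof. by elim: k. Qed.

Lemma wpow_rcons k a w :
  wpow k (a :: w) ++ [:: a] = a :: wpow k (rcons w a).
Proof.
elim: k => //= k IH; rewrite -[in LHS]/(wpow k _) /= -catA IH.
by rewrite -cat_rcons.
Qed.

Lemma wpow_shift k a w p s : wpow k (a :: w) = a :: p ++ s ->
  exists r, wpow k (rcons w a) = p ++ s ++ r.
Proof.
by move=> E; exists [:: a]; move: (wpow_rcons k a w); rewrite E /= -catA => -[].
Qed.

(** A suffix of a power of [w] is a prefix of a power of a cyclic rotation of
    [w], and rotating a word conjugates the element. *)
Lemma wpow_rotate k w p s : wpow k w = p ++ s ->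
  exists w' g r, [/\ size w' = size w, eval w' = eval w ^ g &
                     wpow k w' = s ++ r].
Proof.
elim: p w s => [|b p IH] w s.
  by move=> E; exists w, 1, [::]; rewrite conjg1 cats0.
case: k w IH => [|k] [|a w] IH //; first by rewrite wpow_nil.
move=> E; have [ab _] := E; rewrite -{}ab in E.
have [r /IH[w' [g [r' [sw' ew' E']]]]] := wpow_shift (k := k.+1) E.
exists w', (eval [:: a] * g), (r ++ r'); split.
- by rewrite sw' size_rcons.
- rewrite ew' conjgM; congr (_ ^ g).
  by rewrite (eval_cons a w) -cats1 eval_cat conjgE -mulgA mulKg.
- by rewrite E' -catA.
Qed.

(** A cancelling pair at the start of a power of [w] lies inside one period.
    Otherwise the letter one period after [a] is again [a] and comes no later
    than [letter_inv a]; it is not [letter_inv a], and it is not strictly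
    between, since [a] is not adjacent to itself. *)
Lemma wpow_cancel k w a q r :
    wpow k w = a :: q ++ letter_inv a :: r -> all (fun b => e a.1 b.1) q ->
  exists s, w = a :: q ++ letter_inv a :: s.
Proof.
move=> E aq; have a_q c : (a.1, c) \notin q.
  by apply/negP => /(allP aq) /=; rewrite e_irr.
case: w k E => [|b w] [|k] //; first by rewrite wpow_nil.
case=> ->; rewrite -/(wpow k _) => E.
have aV : letter_inv a <> a by case: (a) => x [].
case: (ltnP (size q) (size w)) => qw.
  exists (drop (size q).+1 w); congr cons.
  have := congr1 (take (size w)) E;
    rewrite take_size_cat // take_cat ltnNge ltnW //=.
  case: (size w - size q) (subn_gt0 (size q) (size w)) => [|m];
    first by rewrite qw.
  by move=> _ -> /=; rewrite drop_cat ltnNge leqnSn /= subSnn /= drop0.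
have Eq : q = w ++ drop (size w) q.
  have := congr1 (take (size w)) E; rewrite take_size_cat // takel_cat //.
  by move=> {1}->; rewrite cat_take_drop.
move: E; rewrite {1}Eq -catA => /(congr1 (drop (size w))).
rewrite !drop_size_cat //.
have: {subset drop (size w) q <= q} by move=> x; apply: mem_drop.
case: k => [|k]; first by case: (drop _ q).
case: (drop _ q) => [|c q'] sub /= [] => [/esym //|ac _].
by have := sub c (mem_head _ _);
  rewrite -ac [a]surjective_pairing (negPf (a_q _)).
Qed.

Definition reduced w := weight (run e (@empty_pile T) w) = size w.

Lemma weight_eval u w : eval u = eval w ->
  weight (run e (@empty_pile T) u) = weight (run e (@empty_pile T) w).
Proof.
move=> /(iffRL (presented_piP _ _ _)) uw.
by rewrite (run_word_eq e_sym e_irr uw (legal_empty e)).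
Qed.

(** If some power of [w] is not reduced, the cancelling pair lies in a rotation
    of [w], which therefore spells a conjugate by a shorter word. *)
Lemma cyclically_reduced w :
  exists w' g, eval w' = eval w ^ g /\ forall k, reduced (wpow k w').
Proof.
have [n] := ubnP (size w); elim: n w => // n IH w; rewrite ltnS => wn.
have [?|/existsNP[k wk]] := pselect (forall k, reduced (wpow k w)).
  by exists w, 1; rewrite conjg1.
case: (run_stackVcancel e_sym e_irr (wpow k w)) => [E|[p [a [q [r [E aq]]]]]].
  by case: wk; rewrite /reduced E weight_stack.
have [w1 [g [r' [s1 e1 E1]]]] := wpow_rotate E.
rewrite /= -catA /= in E1; have [s Es] := wpow_cancel E1 aq.
have eqs : eval w1 = eval (q ++ s).
  have -> : w1 = (a :: q ++ [:: letter_inv a]) ++ s by rewrite Es /= -catA.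
  by rewrite !eval_cat eval_cancel.
have [|w' [h [e' redw']]] := IH (q ++ s).
  apply: leq_trans wn; rewrite -s1 Es /= !size_cat /= addnS.
  by rewrite ltnS leqnSn.
by exists w', (g * h); split=> //; rewrite e' -eqs e1 conjgM.
Qed.

(** A relation rather than a length function: upper bounds on word length
    suffice, and no shortest word has to be chosen. *)
Definition spelled n (g : RAAG e) := exists2 w, size w <= n & eval w = g.

Lemma spelledM m n g h : spelled m g -> spelled n h -> spelled (m + n) (g * h).
Proof.
move=> [u um <-] [w wn <-]; exists (u ++ w); last exact: eval_cat.
by rewrite size_cat leq_add.
Qed.

Lemma spelledV n g : spelled n g -> spelled n g^-1.
Proof.
move=> [w wn <-]; exists (word_inv w); last exact: eval_inv.
by rewrite size_rev size_map.
Qed.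

Lemma spelledX n g k : spelled n g -> spelled (k * n)%N (g ^+ k).
Proof.
move=> [w wn <-]; exists (wpow k w); last exact: eval_wpow.
by rewrite size_wpow leq_mul2l wn orbT.
Qed.

Lemma spelled_ex g : exists n, spelled n g.
Proof. by have [w <-] := eval_surj g; exists (size w), w. Qed.

(** For a cyclically reduced conjugate, spelled by a nonempty word [w], the
    pile of the k-th power has [k * size w] signs. *)
Lemma undistorted z : z <> 1 ->
  exists g, forall k n, spelled n ((z ^ g) ^+ k) -> k <= n.
Proof.
have [w0 <-] := eval_surj z; have [w [g [wg red]]] := cyclically_reduced w0.
move=> z1; exists g => k n [u un]; rewrite -wg -eval_wpow => /weight_eval uk.
have w_gt0 : 0 < size w.
  case: w wg {red uk} => // /esym/eqP; rewrite eval_nil conjg_eq1 => /eqP //.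
apply: leq_trans un; apply: leq_trans (weight_run e u);
  rewrite uk red size_wpow.
exact: leq_pmulr.
Qed.

End WordLength.

(** * Heisenberg triples *)

Section Heisenberg.
Local Open Scope group_scope.

Definition heisenberg (G : groupType) (x y z : G) :=
  [/\ x * y = y * x * z, commute x z & commute y z].

Lemma heisenberg_powers (G : groupType) (x y z : G) m n :
    heisenberg x y z ->
  x ^+ m * y ^+ n = y ^+ n * x ^+ m * z ^+ (m * n).
Proof.
move=> [xy xz yz].
have xyn : x * y ^+ n = y ^+ n * x * z ^+ n.
  elim: n => [|n IH]; first by rewrite !expg0 !mulg1 mul1g.
  rewrite expgSr mulgA IH -!mulgA -(commuteX n yz) (mulgA x) xy expgS.
  by rewrite !mulgA.
elim: m => [|m IH]; first by rewrite !expg0 !mulg1 mul1g.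
rewrite expgS -mulgA IH !mulgA xyn mulSn expgnDr -!mulgA; congr (_ * (_ * _)).
by rewrite !mulgA; congr (_ * _); apply/esym/commuteX2/commute_sym.
Qed.

Lemma heisenberg_expg (G : groupType) (x y z : G) m n :
  heisenberg x y z -> heisenberg (x ^+ m) (y ^+ n) (z ^+ (m * n)).
Proof.
move=> xyz; have [_ xz yz] := xyz.
by split; [exact: heisenberg_powers | exact: commuteX2 | exact: commuteX2].
Qed.

(** [z^(n^2)] is spelled with [O(n)] letters, although [z], if nontrivial, is
    undistorted. *)
Lemma no_heisenberg (T : finType) (e : rel T) (x y z : RAAG e) :
  symmetric e -> irreflexive e -> heisenberg x y z -> z = 1.
Proof.
move=> e_sym e_irr xyz; apply: contrapT.
move=> /(undistorted e_sym e_irr)[g zg].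
have [l xl] := spelled_ex x; have [m ym] := spelled_ex y.
have [d gd] := spelled_ex g.
(* [x ^+ n] and [y ^+ n] each occur twice, and the conjugator once on each side,
   so the linear bound is [2 * n * (l + m) + 2 * d], which is below [n * n] *)
pose n := (2 * (l + m) + 2 * d).+1.
have xn := spelledX n xl; have yn := spelledX n ym.
suff: (n * n <= d + ((n * m + n * l) + (n * l + n * m)) + d)%N.
  by rewrite /n; nia.
apply: zg.
have -> : (z ^ g) ^+ (n * n) =
    g^-1 * ((y ^+ n * x ^+ n)^-1 * (x ^+ n * y ^+ n)) * g.
  by rewrite (heisenberg_powers _ _ xyz) mulKg -conjXg conjgE mulgA.
apply/spelledM/gd/spelledM; first exact: spelledV.
by apply: spelledM; [apply/spelledV/spelledM | apply: spelledM].
Qed.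

(** By pigeonhole, two powers of [x] lie in the same left coset. *)
Lemma finite_index_expg (G : groupType) (S : groupClosed G) (x : G) :
  finite_index S -> exists2 k, 0 < k & x ^+ k \in S.
Proof.
move=> Sfin; apply: contrapT => noS.
pose coset i := left_coset S (x ^+ i).
have coset_neq i j : i < j -> coset i <> coset j.
  move=> ij ijE; have : coset j (x ^+ j) by exists 1; rewrite /= ?mulg1 ?gpred1.
  rewrite -ijE => -[s /= sS xs]; apply: noS.
  exists (j - i); first by rewrite subn_gt0.
  have <- // : s = x ^+ (j - i).
  by apply: (mulgI (x ^+ i)); rewrite xs -expgnDr subnKC ?(ltnW ij).
have coset_inj : {in (classical_sets.setT : set nat) &, injective coset}.
  by move=> i j _ _ ij; case: (ltngtP i j) => // /coset_neq; rewrite ij.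
apply: infinite_nat.
rewrite -(eq_finite_set (inj_card_eq coset_inj)).
by apply: sub_finite_set Sfin => _ [i _ <-]; exists (x ^+ i).
Qed.

(** Powers of [x] and [y] lie in the finite-index subgroup of [H], hence so does
    the corresponding power of [z], which is their commutator; the isomorphism
    carries this triple into [G]. *)
Lemma commensurable_heisenberg (G H : groupType) (x y z : H) :
    (forall a b c : G, heisenberg a b c -> c = 1) ->
    commensurable G H -> heisenberg x y z ->
  exists2 m, 0 < m & z ^+ m = 1.
Proof.
move=> G_free [U [V [_ /finite_index_expg Vfin [f [g fK gK]]]]] xyz.
have [k k_gt0 xV] := Vfin x; have [l l_gt0 yV] := Vfin y.
have gM : {morph g : a b / a * b} := can2_gmulfM fK gK.
have hk := heisenberg_expg k l xyz; have [xy _ _] := hk.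
have zV : z ^+ (k * l) \in V.
  have -> : z ^+ (k * l) = (y ^+ l * x ^+ k)^-1 * (x ^+ k * y ^+ l).
    by rewrite xy mulKg.
  by rewrite gpredM ?gpredV ?gpredM.
exists (k * l)%N; first by rewrite muln_gt0 k_gt0.
pose x' : subgroup V := exist (fun a => a \in V) _ xV.
pose y' : subgroup V := exist (fun a => a \in V) _ yV.
pose z' : subgroup V := exist (fun a => a \in V) _ zV.
have gz1 : val (g z') = 1.
  apply: (G_free (val (g x')) (val (g y'))).
  case: hk => _ xz yz.
  by split; rewrite /commute -!valM -!gM; congr (val (g _)); apply: val_inj.
(* [g] is only known to preserve products, so triviality is transported as
   idempotence *)
have z1 : z' * z' = z' * 1.
  apply: (can_inj gK); rewrite gM mulg1; apply: val_inj.
  by rewrite valM gz1 mulg1.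
by have /(congr1 val) := mulgI z' _ _ z1.
Qed.
End Heisenberg.

(** * Outer automorphisms of a free abelian group *)

Import GRing.Theory Num.Theory.

Section OuterAutZn.
Local Open Scope ring_scope.
Variable n : nat.
Let Zn := Algebra.to_multiplicative 'rV[int]_n.

(** Vectors are rows, so the transpose makes the action covariant. *)
Lemma GL_automorphic (A : GL int n) :
  automorphic ((fun v : 'rV[int]_n => v *m (val A)^T) : Zn -> Zn).
Proof.
split; last by move=> u v; apply: mulmxDl.
have AT : (val A)^T \in unitmx by rewrite unitmx_tr (valP A).
by exists (fun v : 'rV[int]_n => v *m invmx (val A)^T) => v;
  rewrite ?mulmxK ?mulmxKV.
Qed.

Definition GL_out (A : GL int n) : out Zn :=
  \pi_(out Zn)%qT (mk_aut (GL_automorphic A)).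

Lemma GL_outM : {morph GL_out : A B / (A * B)%g}.
Proof.
move=> A B; rewrite /GL_out -[RHS]/(quotient_mul _ _) quotient_piM;
  congr (\pi_(out Zn)%qT _).
by apply: aut_eqP => v /=; rewrite /aut_fun /= trmx_mul mulmxA.
Qed.

(** Conjugation is trivial in an abelian group. *)
Lemma out_pi_inj (f g : aut Zn) :
  \pi_(out Zn)%qT f = \pi_(out Zn)%qT g -> f = g.
Proof.
move=> /eqmodP /asboolP[a fg].
have fgE : (f^-1 * g)%g = 1%g.
  by apply: aut_eqP => v; rewrite fg (Algebra.commuteT a v) mulgK.
by rewrite -[g](mulVKg f) fgE mulg1.
Qed.

Lemma GL_out_inj : injective GL_out.
Proof.
move=> A B /out_pi_inj/(congr1 (@aut_fun _)) AB; apply: val_inj;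
  apply: trmx_inj.
by apply/row_matrixP => i; have := congr1 (@^~ (delta_mx 0 i)) AB;
  rewrite /= !rowE.
Qed.

(** Additive maps between [Z]-modules are automatically [Z]-linear. *)
Lemma additive_mulmx (f : 'rV[int]_n -> 'rV[int]_n) :
  {morph f : u v / u + v} -> exists M, forall v, f v = v *m M.
Proof.
move=> fD.
have fB : zmod_morphism f.
  by move=> u v; apply: (addIr (f v)); rewrite -fD !subrK.
pose F : {additive _ -> _} := HB.pack f (GRing.isZmodMorphism.Build _ _ f fB).
exists (\matrix_i f (delta_mx 0 i)) => v.
rewrite mulmx_sum_row {1}[v]row_sum_delta -[f _]/(F _) raddf_sum.
by apply: eq_bigr => i _; rewrite rowK -[v 0 i]intz !scaler_int raddfMz.
Qed.

Lemma GL_out_surj (q : out Zn) : exists A, GL_out A = q.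
Proof.
rewrite -[q](@reprK _ (out Zn)); set f := repr q.
have [[g fK gK] fM] := autP f.
have [M fE] := additive_mulmx fM.
have gM : {morph g : u v / u + v :> 'rV[int]_n}.
  by move=> u v; apply: (can_inj fK); rewrite [RHS]fM !gK.
have [N gE] := additive_mulmx gM.
have MN : M *m N = 1%:M.
  by apply/row_matrixP => i; rewrite !rowE mulmxA -fE -gE fK mulmx1.
have [Mu _] := mulmx1_unit MN.
have MT : M^T \in unitmx by rewrite unitmx_tr.
exists (exist (fun A : 'M_n => A \in unitmx) M^T MT : GL int n).
by congr (\pi_(out Zn)%qT _); apply: aut_eqP => v;
  rewrite [RHS]fE /aut_fun /= trmxK.
Qed.

Lemma GL_out1 : GL_out 1%g = 1%g.
Proof. by apply: (mulgI (GL_out 1%g)); rewrite -GL_outM !mulg1. Qed.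

Lemma GL_out_expg A m : GL_out (A ^+ m)%g = (GL_out A ^+ m)%g.
Proof. by elim: m => [|m IH]; [exact: GL_out1 | rewrite !expgS GL_outM IH]. Qed.

Lemma isomorphic_out_GL : isomorphic (out Zn) (GL int n).
Proof.
pose F q := sval (cid (GL_out_surj q)).
have FK : cancel F GL_out by move=> q; rewrite /F; case: cid.
have GK : cancel GL_out F by move=> A; apply: GL_out_inj; rewrite FK.
have FM : {morph F : p q / (p * q)%g}.
  by move=> p q; apply: GL_out_inj; rewrite GL_outM !FK.
pose phi : {multiplicative out Zn -> GL int n} :=
  HB.pack F (isMultiplicative.Build _ _ F FM).
by exists phi; exists GL_out.
Qed.

End OuterAutZn.

(** * Elementary matrices *)

Section Elementary.
Local Open Scope ring_scope.
Variables (R : comUnitRingType) (n : nat).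
Implicit Types (i j k : 'I_n) (a b : R).

Definition elem_mx i j a : 'M[R]_n := 1%:M + a *: delta_mx i j.

Lemma elem_mxM i j k l a b :
  elem_mx i j a *m elem_mx k l b =
  1%:M + (a *: delta_mx i j + b *: delta_mx k l)
    + (a * b) *: (delta_mx i l *+ (j == k)).
Proof.
rewrite mulmxDl mul1mx mulmxDr mulmx1 -scalemxAl -scalemxAr.
by rewrite mul_delta_mx_cond scalerA -!addrA; congr (1%:M + _); apply: addrCA.
Qed.

Lemma elem_mxM_neq i j k l a b : j != k ->
  elem_mx i j a *m elem_mx k l b =
  1%:M + (a *: delta_mx i j + b *: delta_mx k l).
Proof. by move=> /negPf jk; rewrite elem_mxM jk mulr0n scaler0 addr0. Qed.

Lemma elem_mxD i j a b : i != j ->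
  elem_mx i j a *m elem_mx i j b = elem_mx i j (a + b).
Proof. by move=> ij; rewrite elem_mxM_neq 1?eq_sym // -scalerDl. Qed.

Lemma elem_mx_unit i j a : i != j -> elem_mx i j a \in unitmx.
Proof.
move=> ij; have : elem_mx i j a *m elem_mx i j (- a) = 1%:M.
  by rewrite elem_mxD // subrr /elem_mx scale0r addr0.
by case/mulmx1_unit.
Qed.

Lemma elem_mx_commute i j k l a b : j != k -> l != i ->
  elem_mx i j a *m elem_mx k l b = elem_mx k l b *m elem_mx i j a.
Proof. by move=> jk li; rewrite !elem_mxM_neq // (addrC (a *: _)). Qed.

Lemma elem_mx_heisenberg i j k a b : i != j -> j != k -> i != k ->
  elem_mx i j a *m elem_mx j k b =
  elem_mx j k b *m elem_mx i j a *m elem_mx i k (a * b).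
Proof.
move=> ij jk ik; rewrite elem_mxM eqxx mulr1n elem_mxM_neq 1?eq_sym //.
rewrite mulmxDr mulmx1 !mulmxDl mul1mx -!scalemxAl -!scalemxAr
  !mul_delta_mx_cond.
rewrite [k == i]eq_sym (negPf ik) [j == i]eq_sym (negPf ij) !mulr0n !scaler0
  !addr0.
by rewrite (addrC (a *: _)).
Qed.

Definition elem_GL i j (ij : i != j) a : GL R n :=
  exist (fun A : 'M_n => A \in unitmx) (elem_mx i j a) (elem_mx_unit a ij).

Lemma elem_GL_heisenberg i j k (ij : i != j) (jk : j != k) (ik : i != k) a b :
  heisenberg (elem_GL ij a) (elem_GL jk b) (elem_GL ik (a * b)).
Proof.
split; apply: val_inj; first exact: elem_mx_heisenberg.
  by apply: elem_mx_commute; rewrite eq_sym.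
by apply: elem_mx_commute; rewrite eq_sym.
Qed.

Lemma elem_GL_expg i j (ij : i != j) a m :
  (elem_GL ij a ^+ m)%g = elem_GL ij (a *+ m).
Proof.
elim: m => [|m IH]; apply: val_inj; first by rewrite /= /elem_mx scale0r addr0.
by rewrite expgS IH mulrS /=; apply: elem_mxD.
Qed.

Lemma elem_GL_eq1 i j (ij : i != j) a : (elem_GL ij a = 1)%g -> a = 0.
Proof.
move=> /(congr1 (fun A : GL R n => val A i j));
  rewrite /= !mxE !eqxx (negPf ij).
by rewrite mulr1 add0r.
Qed.
End Elementary.

(** * Right-angled Artin groups and GL_n(Z) *)

Theorem theorem7 (n : nat) (n_ge3 : (3 <= n)%N) :
  isomorphic (out (Algebra.to_multiplicative 'rV[int]_n)) (GL int n) /\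
  forall (V : finType) (adj : rel V),
    symmetric adj -> irreflexive adj ->
    ~ commensurable (RAAG adj) (out (Algebra.to_multiplicative 'rV[int]_n)).
Proof.
split=> [|V adj adj_sym adj_irr comm]; first exact: isomorphic_out_GL.
pose i m (m_lt3 : m < 3) : 'I_n := Ordinal (leq_trans m_lt3 n_ge3).
have i01 : i 0 isT != i 1 isT by [].
have i12 : i 1 isT != i 2 isT by [].
have i02 : i 0 isT != i 2 isT by [].
have [xy xz yz] := elem_GL_heisenberg i01 i12 i02 (1 : int)%R (1 : int)%R.
have RAAG_free (a b c : RAAG adj) : heisenberg a b c -> c = 1%g.
  exact: no_heisenberg.
have [|m m_gt0] := commensurable_heisenberg RAAG_free comm
  (x := GL_out (elem_GL i01 1%R)) (y := GL_out (elem_GL i12 1%R))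
  (z := GL_out (elem_GL i02 (1 * 1)%R)).
  by split; rewrite /commute -!GL_outM ?xy ?xz ?yz.
rewrite -GL_out_expg -GL_out1 => /GL_out_inj; rewrite elem_GL_expg mulr1.
by move=> /elem_GL_eq1/eqP; rewrite pnatr_eq0 => /eqP m0; rewrite m0 in m_gt0.
Qed.
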